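(* There exist exactly $$\begin{bmatrix}n\\ n-2\end{bmatrix}_2\cdot\left(2^{n-2}-1\right)$$ distinct elementary abelian regular subgroups $\mathcal{T}\le\mathrm{AGL}(V)$ such that $\dim(W(\mathcal{T}))=n-2$.
   Context: $n\ge 2$ and $V=(\mathbb{F}_2)^n$. $T=\{\sigma_a\mid a\in V\}$, where $\sigma_a:x\mapsto x+a$, is the translation group, and $\mathrm{AGL}(V)=\mathrm{GL}(V)\ltimes T$. For an elementary abelian regular subgroup $\mathcal{T}\le\mathrm{AGL}(V)$ (regular in its action on $V$), $W(\mathcal{T})=\{a\in V\mid\sigma_a\in\mathcal{T}\}$, a subspace of $V$. $\begin{bmatrix}n\\ d\end{bmatrix}_2=\prod_{i=0}^{d-1}\frac{2^{n-i}-1}{2^{d-i}-1}$ is the Gaussian binomial (equal to $1$ for $d=0$). *)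

(* Defs.v *)
From mathcomp Require Import all_boot all_order all_fingroup all_algebra all_solvable.

Set Implicit Arguments.
Unset Strict Implicit.
Unset Printing Implicit Defensive.

Import GroupScope GRing.Theory.

Notation V n := 'rV['F_2]_n.

Section Affine.

Variable n : nat.

Definition transl (a : V n) : {perm V n} := perm (@addIr _ a).

Lemma translE a x : transl a x = (x + a)%R.
Proof. by rewrite permE. Qed.

Lemma translD a b : transl (a + b)%R = transl a * transl b.
Proof. by apply/permP => x; rewrite permM !translE addrA. Qed.

Lemma transl0 : transl 0%R = 1.
Proof. by apply/permP => x; rewrite translE addr0 perm1. Qed.

Definition translations : {set {perm V n}} := [set transl a | a : V n].

Lemma translations_group_set : group_set translations.
Proof.
apply/group_setP; split=> [|s t /imsetP[a _ ->] /imsetP[b _ ->]].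
  by rewrite -transl0 imset_f.
by rewrite -translD imset_f.
Qed.

Canonical translations_group := Group translations_group_set.

Definition GLV : {set {perm V n}} :=
  [set s : {perm V n} |
    [forall c : 'F_2, forall x, forall y,
       s (c *: x + y)%R == (c *: s x + s y)%R]].

Lemma GLVP (s : {perm V n}) : reflect (linear s) (s \in GLV).
Proof.
rewrite inE; apply: (iffP forallP) => [H c x y | H c].
  by have /forallP/(_ x)/forallP/(_ y)/eqP := H c.
by apply/forallP => x; apply/forallP => y; rewrite H.
Qed.

Lemma GLV_group_set : group_set GLV.
Proof.
apply/group_setP; split=> [|s t /GLVP ls /GLVP lt].
  by apply/GLVP => c x y; rewrite !perm1.
by apply/GLVP => c x y; rewrite !permM ls lt.
Qed.

Canonical GLV_group := Group GLV_group_set.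

(* The join of the two subgroups of {perm V n}; sdprod_AGL shows that it is
   their internal semidirect product. *)
Definition AGL : {group {perm V n}} := (translations <*> GLV)%G.

Lemma GLV0 s : s \in GLV -> s 0%R = 0%R.
Proof.
move=> /GLVP/(_ 1%R 0%R 0%R); rewrite !scale1r addr0 => /esym/eqP.
by rewrite -subr_eq0 addrK => /eqP.
Qed.

Lemma sdprod_AGL : translations ><| GLV = AGL.
Proof.
rewrite /= sdprodEY //.
  apply/subsetP => s sG; rewrite inE; apply/subsetP => t.
  case/imsetP => u /imsetP[a _ ->] ->; apply/imsetP; exists (s a) => //.
  have /GLVP ls := sG.
  apply/permP => x; rewrite /conjg !permM !translE -[X in (X + a)%R]scale1r ls.
  by rewrite scale1r permKV.
apply/trivgP/subsetP => s /setIP[/imsetP[a _ ->] /GLV0].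
by rewrite translE add0r => ->; rewrite transl0 inE.
Qed.

Definition regular (G : {set {perm V n}}) : bool :=
  [transitive G, on [set: V n] | 'P] && [forall x : V n, 'C_G[x | 'P] == 1].

(* The span only serves to obtain an object of type {vspace V n}: by mem_W, no
   vector is added, as the set is already a subspace when G is a group. *)
Definition W (G : {group {perm V n}}) : {vspace V n} :=
  <<enum [set a : V n | transl a \in G]>>%VS.

Lemma mem_W (G : {group {perm V n}}) a : (a \in W G) = (transl a \in G).
Proof.
apply/idP/idP => [aW | aG]; last by apply: memv_span; rewrite mem_enum inE.
rewrite (coord_span (X := in_tuple _) aW).
apply: (big_ind (fun b => transl b \in G)) => [|b c bG cG|i _].
- by rewrite transl0 group1.
- by rewrite translD groupM.
set b := nth _ _ _.
have bG : transl b \in G.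
  have: b \in enum [set a : V n | transl a \in G] by apply: mem_nth.
  by rewrite mem_enum inE.
case: (coord _ _ _) => [[|[|//]] lti].
  by rewrite (_ : Ordinal lti = 0%R) ?scale0r ?transl0 ?group1 //; apply: val_inj.
by rewrite (_ : Ordinal lti = 1%R) ?scale1r //; apply: val_inj.
Qed.

End Affine.

Definition gauss_binom (q n d : nat) : rat :=
  (\prod_(i < d) ((q%:R ^+ (n - i) - 1) / (q%:R ^+ (d - i) - 1)))%R.

(* Main.v *)
Require Import Defs.
From mathcomp Require Import all_boot all_order all_fingroup all_algebra all_solvable.
From mathcomp Require Import ring.

Set Implicit Arguments.
Unset Strict Implicit.
Unset Printing Implicit Defensive.

Import GroupScope GRing.Theory.

Local Open Scope ring_scope.

(** Elementary abelian regular subgroups of the affine group are the same thing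
as algebra structures on V.  If G is one of them, write t_y for the element of
G that sends 0 to y and put x.y = t_y(x) + x + y.  Since t_y is affine, this
product is additive in x; since G is abelian it is commutative, and since G is
closed under composition it is associative; since G has exponent 2 it satisfies
x.x = 0.  Conversely each such product m makes V a group for the circle
operation x + y + m x y, whose translations form an elementary abelian regular
subgroup, [circle m].  So groups correspond to products ([circle_of_regular],
[circle_injective]), and W(G) is the annihilator of the product ([W_circle]).

When the annihilator W has codimension 2, the product factors through a plane
V/W with basis u, v; being alternating, it is determined by the single value
w = u.v.  It is therefore m x y = (al(x) be(y) + al(y) be(x)) w, where al and
be are independent linear functionals with W as common kernel
([wedge_of_codim2]).  Associativity forces w in W: for instance
u.w = (u.u).v = 0.  Conversely al, be and w with w <> 0 and
al(w) = be(w) = 0 always define a suitable product ([wedge_alg], [wedge_ann],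
[dim_codim2]).

The groups are thus parametrized by triples (w, (al, be)).  The vector w is
determined by the group, and so is the plane spanned by al and be, whereas any
ordered pair of distinct nonzero vectors of this plane gives the same group:
the parametrization is 6 to 1 ([wedge_group_fibre]).  Choosing w first, then
al and be in the hyperplane of functionals that kill w, one finds
(2^n - 1) (2^(n-1) - 1) (2^(n-1) - 2) triples ([card_triples]).  Finally the
Gaussian binomial equals (2^n - 1) (2^(n-1) - 1) / 3 ([gauss_binom_codim2]),
so that no enumeration of subspaces is needed. *)

(** * Arithmetic in characteristic two *)

Lemma F2_ind (P : 'F_2 -> Prop) : P 0 -> P 1 -> forall c, P c.
Proof.
move=> P0 P1 [[|[|//]] lt_c].
  by rewrite (_ : Ordinal lt_c = 0) //; apply: val_inj.
by rewrite (_ : Ordinal lt_c = 1) //; apply: val_inj.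
Qed.

Lemma F2_bool (c : 'F_2) : exists b : bool, c = b%:R.
Proof. by elim/F2_ind: c; [exists false | exists true]. Qed.

Lemma F2_addb (b c : bool) : b%:R + c%:R = (b (+) c)%:R :> 'F_2.
Proof. by case: b c => [] []; apply: val_inj. Qed.

Lemma F2_0b : 0 = false%:R :> 'F_2.
Proof. by []. Qed.

(** Decides the identities of abelian groups of exponent 2: on each
coordinate, sums over F_2 become exclusive disjunctions, and all cases are
tried. *)
Ltac char2 :=
  apply/rowP => ?; rewrite !mxE;
  repeat match goal with
  | |- context [fun_of_matrix ?A 0%R ?i] =>
      let b := fresh in
      move: (fun_of_matrix A 0%R i) => b; case: (F2_bool b) => {b} ? ->
  end;
  rewrite ?F2_0b ?F2_addb; congr (nat_of_bool _)%:R;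
  repeat match goal with b : bool |- _ => case: b end; reflexivity.

Lemma addvv n (x : V n) : x + x = 0.
Proof. by char2. Qed.

Lemma addKv n (x y : V n) : x + (x + y) = y.
Proof. by char2. Qed.

(** Over F_2 scalars impose no condition, so that a permutation is affine as
soon as it respects sums of three vectors. *)
Lemma AGLP n (g : {perm V n}) :
  reflect (forall x y, g (x + y) = g x + g y + g 0) (g \in AGL n).
Proof.
have defA : AGL n = (translations n * GLV n)%g :> {set _}.
  by case/sdprodP: (sdprod_AGL n).
rewrite defA; apply: (iffP mulsgP) =>
  [[t s /imsetP[a _ ->] /GLVP ls ->] x y | gD].
  have sD u v : s (u + v) = s u + s v by rewrite -[u]scale1r ls !scale1r.
  rewrite !permM !translE add0r !sD; char2.
have s_inj : injective (fun x => g x + g 0).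
  by move=> x y /addIr /perm_inj.
(* The translation comes first in the product: g x = s (x + a) with s a = g 0,
   hence a = g^-1 0. *)
exists (transl ((g^-1)%g 0)) (perm s_inj); first exact: imset_f.
  apply/GLVP => c x y; elim/F2_ind: c; rewrite !permE.
    by rewrite !scale0r !add0r.
  by rewrite !scale1r gD; char2.
apply/permP => x; rewrite permM translE permE gD permKV; char2.
Qed.

(** * Algebras and their circle groups *)

Definition alt_algebra n (m : V n -> V n -> V n) : Prop :=
  [/\ forall x y z, m (x + y) z = m x z + m y z,
      forall x, m x x = 0,
      forall x y, m x y = m y x
    & forall x y z, m (m x y) z = m x (m y z)].

(** The right translations x |-> x + a + m x a of the circle operation. As a
is the image of 0, membership can be tested without naming a, and the set
makes sense even when these maps fail to be bijective. *)
Definition circle n (m : V n -> V n -> V n) : {set {perm V n}} :=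
  [set g : {perm V n} | [forall x, g x == x + g 0 + m x (g 0)]].

Lemma circleP n (m : V n -> V n -> V n) (g : {perm V n}) :
  reflect (forall x, g x = x + g 0 + m x (g 0)) (g \in circle m).
Proof. by rewrite inE; apply: (iffP forallP) => H x; apply/eqP; apply: H. Qed.

Lemma circle_inj0 n (m : V n -> V n -> V n) g h :
  g \in circle m -> h \in circle m -> g 0 = h 0 -> g = h.
Proof.
by move=> /circleP gE /circleP hE e; apply/permP => x; rewrite gE hE e.
Qed.

Section Circle.

Variables (n : nat) (m : V n -> V n -> V n).
Hypothesis m_alg : alt_algebra m.

Let mDl x y z : m (x + y) z = m x z + m y z.
Proof. by case: m_alg. Qed.
Let mxx x : m x x = 0.
Proof. by case: m_alg. Qed.
Let mC x y : m x y = m y x.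
Proof. by case: m_alg. Qed.
Let mA x y z : m (m x y) z = m x (m y z).
Proof. by case: m_alg. Qed.
Let mDr x y z : m x (y + z) = m x y + m x z.
Proof. by rewrite mC mDl !(mC _ x). Qed.

Lemma alt0l x : m 0 x = 0.
Proof. by rewrite -(addvv 0) mDl !addvv. Qed.

Lemma alt0r x : m x 0 = 0.
Proof. by rewrite mC alt0l. Qed.

Lemma alt_mulK x y : m (m x y) y = 0.
Proof. by rewrite mA mxx alt0r. Qed.

(** The maps x |-> x + a + m x a are involutions, because (x.a).a = x.(a.a) =
0. *)
Lemma circle_ex a : exists2 g, g \in circle m & g 0 = a.
Proof.
have f_inv : involutive (fun x => x + a + m x a).
  by move=> x /=; rewrite !mDl mxx alt_mulK; char2.
exists (perm (inv_inj f_inv)); last by rewrite permE alt0l add0r addr0.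
by apply/circleP => x; rewrite !permE alt0l add0r addr0.
Qed.

Lemma circle_group_set : group_set (circle m).
Proof.
apply/group_setP; split=> [|g h /circleP gE /circleP hE].
  by apply/circleP => x; rewrite !perm1 alt0r !addr0.
apply/circleP => x; rewrite !permM (hE (g x)) (hE (g 0)) (gE x).
by rewrite !mDl !mDr mA; apply/rowP => i; rewrite !mxE; ring.
Qed.

Definition circle_group : {group {perm V n}} := Group circle_group_set.

Lemma circle_abelem : is_abelem circle_group.
Proof.
apply/is_abelemP; exists 2%N => //; apply/abelemP => //; split.
  apply/centsP => g gG h hG.
  apply: (circle_inj0 (m := m)); rewrite ?(groupM (G := circle_group)) //.
  have /circleP gE := gG; have /circleP hE := hG.
  by rewrite !permM (gE (h 0)) (hE (g 0)) (mC (h 0)) (addrC (h 0)).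
move=> g gG; apply: (circle_inj0 (m := m)).
- exact: (groupX (G := circle_group)).
- exact: (group1 circle_group).
have /circleP gE := gG.
by rewrite expgS expg1 permM perm1 gE mxx addvv addr0.
Qed.

Lemma circle_regular : regular circle_group.
Proof.
apply/andP; split.
  apply/imsetP; exists 0; rewrite ?inE //; apply/esym/setP => a.
  rewrite !inE; have [g gG <-] := circle_ex a.
  by apply/orbitP; exists g.
apply/forallP => x; apply/eqP/trivgP/subsetP => g /setIP[gG /astab1P gx].
have /circleP gE := gG.
suff g0 : g 0 = 0.
  rewrite inE; apply/eqP/(circle_inj0 gG); first exact: (group1 circle_group).
  by rewrite perm1.
(* A fixed point x of g gives x.a = a for a = g 0, whence
   a = x.(x.a) = (x.x).a = 0. *)
have eq_m : m x (g 0) = g 0.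
  have := gE x; have -> : g x = x by [].
  move/(congr1 (+%R (x + g 0))); rewrite addKv => <-; char2.
by rewrite -eq_m -eq_m -mA mxx alt0l.
Qed.

Lemma circle_AGL : circle_group \subset AGL n.
Proof.
apply/subsetP => g /circleP gE; apply/AGLP => x y.
by rewrite (gE (x + y)) (gE x) (gE y) mDl; char2.
Qed.

Lemma W_circle a : reflect (forall x, m x a = 0) (a \in W circle_group).
Proof.
rewrite mem_W; apply: (iffP (circleP _ _)) => H x.
  have := H x; rewrite !translE add0r => /(congr1 (+%R (x + a))).
  by rewrite addvv addKv.
by rewrite !translE add0r H addr0.
Qed.

End Circle.

Lemma circle_injective n (m m' : V n -> V n -> V n) :
  alt_algebra m -> circle m = circle m' -> m =2 m'.
Proof.
move=> m_alg eq_c x a; have [g gm <-] := circle_ex m_alg a.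
have gm' : g \in circle m' by rewrite -eq_c.
have /circleP/(_ x) := gm; have /circleP/(_ x) -> := gm'.
by move/addrI.
Qed.

Lemma regular_sharply_transitive n (G : {group {perm V n}}) : regular G ->
     (forall a, exists g, g \in G /\ g 0 = a)
  /\ {in G &, forall g h : {perm V n}, g 0 = h 0 -> g = h}.
Proof.
case/andP=> trG /forallP/(_ 0)/eqP st0; split=> [a | g h gG hG eq_gh].
  have : a \in orbit 'P G 0 by rewrite (atransP trG) ?inE.
  by case/orbitP=> g gG <-; exists g.
apply/eqP; rewrite eq_mulgV1 -in_set1 -[[set 1%g]]/(1%g : {set _}) -st0.
rewrite inE groupM ?groupV //; apply/astab1P.
by rewrite /= /aperm permM eq_gh permK.
Qed.

Lemma card_V n : #|{: V n}| = (2 ^ n)%N.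
Proof. by rewrite card_mx card_Fp // mul1n. Qed.

(** A regular group has the order 2 ^ n of V, so that 2 is the prime hidden in
[is_abelem]. *)
Lemma regular_abelem_sqr n (G : {group {perm V n}}) :
  regular G -> is_abelem G -> {in G, forall g, (g * g)%g = 1%g}.
Proof.
case/andP=> trG /forallP/(_ 0)/eqP st0 abG g gG.
have cardG : #|G| = (2 ^ n)%N.
  rewrite -(card_orbit_stab 'P G 0) st0 cards1 muln1 (atransP trG) ?inE //.
  by rewrite cardsT card_V.
case: n => [|k] in G trG st0 abG g gG cardG *.
  move/eqP: cardG; rewrite -trivg_card1 => /eqP G1.
  by move: gG; rewrite G1 => /set1P->; rewrite mulg1.
move: abG; rewrite /is_abelem cardG pdiv_pfactor //.
by case/(abelemP (isT : prime 2)) => _ /(_ g gG); rewrite expgS expg1.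
Qed.

(** The product x.y = t_y(x) + x + y recovers from G the algebra whose circle
group it is. Commutativity comes from t_y(x) = t_y(t_x(0)) = t_x(t_y(0)), and
associativity from t_z t_y = t_c with c = t_z(y). *)
Lemma circle_of_regular n (G : {group {perm V n}}) :
    G \subset AGL n -> is_abelem G -> regular G ->
  exists2 m, alt_algebra m & G = circle m :> {set _}.
Proof.
move=> sGA abG regG; have sqG := regular_abelem_sqr regG abG.
have /abelem_abelian/centsP cGG := abG.
have [/fin_all_exists[t tP] injG] := regular_sharply_transitive regG.
have tG a : t a \in G by have [] := tP a.
have t0 a : t a 0 = a by have [] := tP a.
have tD a x y : t a (x + y) = t a x + t a y + a.
  by have /AGLP-> := subsetP sGA _ (tG a); rewrite t0.
have tC a b : t a b = t b a.
  by rewrite -{1}(t0 b) -{2}(t0 a) -!permM (cGG _ (tG b) _ (tG a)).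
have tt a b x : t b (t a x) = t (t b a) x.
  rewrite -permM; congr (fun_of_perm _ x); apply: injG; rewrite ?groupM //.
  by rewrite permM !t0.
exists (fun x y => t y x + x + y).
  split=> [x y z|x|x y|x y z].
  - by rewrite tD; char2.
  - have -> : t x x = 0 by rewrite -{2}(t0 x) -permM sqG // perm1.
    by rewrite add0r addvv.
  - by rewrite tC addrAC.
  - have -> : t (t z y + y + z) x = t z (t y x) + t y x + t z x.
      by rewrite tt -(tC x (t z y)) (tC y x) (tC z x) tC !tD; char2.
    by rewrite !tD; char2.
apply/setP => g; apply/idP/circleP => [gG x | gE].
  have -> : g = t (g 0) by apply: injG; rewrite ?t0.
  by rewrite t0; char2.
have -> // : g = t (g 0).
by apply/permP => x; rewrite gE; char2.
Qed.

(** * The algebras of a codimension-two annihilator *)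

(** Linear functionals are column vectors, so that they form a finite type of
known cardinality. *)
Definition ev n (al : 'cV['F_2]_n) (x : V n) : 'F_2 := (x *m al) 0 0.

Lemma evD n (al : 'cV_n) (x y : V n) : ev al (x + y) = ev al x + ev al y.
Proof. by rewrite /ev mulmxDl mxE. Qed.

Lemma evZ n (al : 'cV_n) c (x : V n) : ev al (c *: x) = c * ev al x.
Proof. by rewrite /ev -scalemxAl mxE. Qed.

Lemma evDl n (al be : 'cV_n) (x : V n) : ev (al + be) x = ev al x + ev be x.
Proof. by rewrite /ev mulmxDr mxE. Qed.

Lemma ev0l n (x : V n) : ev 0 x = 0.
Proof. by rewrite /ev mulmx0 mxE. Qed.

Lemma ev_delta n (al : 'cV_n) i : ev al (delta_mx 0 i) = al i 0.
Proof. by rewrite /ev -rowE mxE. Qed.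

Lemma ev_inj n (al be : 'cV_n) : ev al =1 ev be -> al = be.
Proof. by move=> e; apply/colP => i; rewrite -!ev_delta e. Qed.

Lemma ev_of_linear n (f : {linear V n -> ('F_2)^o}) : exists al, ev al =1 f.
Proof.
exists (\col_i f (delta_mx 0 i)) => x.
rewrite {2}[x]row_sum_delta linear_sum /ev mxE; apply: eq_bigr => i _.
by rewrite mxE linearZ.
Qed.

(** The witnesses u and v make the independence of al and be usable by
evaluation. *)
Definition dual_to n (al be : 'cV_n) (u v : V n) :=
  [/\ ev al u = 1, ev be u = 0, ev al v = 0 & ev be v = 1].

Lemma dual_neq n (al be : 'cV_n) u v :
  dual_to al be u v -> [/\ al != 0, be != 0 & al != be].
Proof.
case=> au bu av bv; split; apply/eqP => e.
- by move: au; rewrite e ev0l.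
- by move: bv; rewrite e ev0l.
- by move: au; rewrite e bu.
Qed.

Lemma F2_neq0 (c : 'F_2) : c != 0 -> c = 1.
Proof. by elim/F2_ind: c. Qed.

(** Over F_2, two functionals are independent when they are nonzero and
distinct. A vector z on which they differ is one of the two dual vectors; the
other one is a vector on which the other functional is 1, corrected by z if
necessary. *)
Lemma dual_ex n (al be : 'cV['F_2]_n) :
  al != 0 -> be != 0 -> al != be -> exists u v, dual_to al be u v.
Proof.
move=> al0 be0 neq.
have ev1 (ga : 'cV['F_2]_n) : ga != 0 -> exists x, ev ga x = 1.
  move=> ga0; have [x /F2_neq0 gx] : exists x, ev ga x != 0; last by exists x.
  apply/existsP; apply: contraNT ga0; rewrite negb_exists => /forallP ga0.
  by apply/eqP/ev_inj => x; rewrite ev0l; apply/eqP/negPn.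
have [x ax] := ev1 _ al0; have [y b_y] := ev1 _ be0.
have F2_01 (c : 'F_2) : c = 0 \/ c = 1 by elim/F2_ind: c; auto.
have [|z] := ev1 (al - be); first by rewrite subr_eq0.
have -> : al - be = al + be.
  apply/colP => i; rewrite !mxE; congr (_ + _).
  by elim/F2_ind: (be i 0); apply: val_inj.
rewrite evDl /dual_to; case: (F2_01 (ev al z)) => az.
  rewrite az add0r => bz; case: (F2_01 (ev be x)) => bx; first by exists x, z.
  exists (x + z), z; rewrite !evD ax bx az bz addr0.
  by split=> //; apply: val_inj.
move=> bz; have {}bz : ev be z = 0.
  by move: bz; rewrite az; elim/F2_ind: (ev be z).
case: (F2_01 (ev al y)) => ay; first by exists z, y.
exists z, (y + z); rewrite !evD ay b_y az bz addr0.
by split=> //; apply: val_inj.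
Qed.

(** The alternating form al /\ be, with values in the line spanned by w. *)
Definition wedge n (al be : 'cV_n) (w x y : V n) : V n :=
  (ev al x * ev be y + ev al y * ev be x) *: w.

(** Products of three factors vanish, since w lies in the kernel of the form;
this is how associativity holds. *)
Lemma wedge_alg n (al be : 'cV_n) (w : V n) :
  ev al w = 0 -> ev be w = 0 -> alt_algebra (wedge al be w).
Proof.
move=> aw bw; rewrite /wedge; split=> [x y z | x | x y | x y z].
- by rewrite !evD -scalerDl; congr (_ *: _); ring.
- have -> : ev al x * ev be x + ev al x * ev be x = 0.
    by elim/F2_ind: (ev al x * ev be x); apply: val_inj.
  by rewrite scale0r.
- by rewrite addrC.
- by rewrite !evZ aw bw !(mulr0, mul0r, addr0) !scale0r.
Qed.

Lemma dimVf n : \dim {: V n} = n.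
Proof. by rewrite dimvf dim_matrix; exact: mul1n. Qed.

Section Dual.

Variables (n : nat) (al be : 'cV['F_2]_n) (u v : V n).
Hypothesis uv : dual_to al be u v.

Lemma wedge_u w x : wedge al be w x u = ev be x *: w.
Proof. by case: uv => au bu _ _; rewrite /wedge au bu mulr0 add0r mul1r. Qed.

Lemma wedge_v w x : wedge al be w x v = ev al x *: w.
Proof. by case: uv => _ _ av bv; rewrite /wedge av bv mul0r addr0 mulr1. Qed.

Lemma wedge_ann (w a : V n) : w != 0 ->
  (forall x, wedge al be w x a = 0) <-> (ev al a = 0 /\ ev be a = 0).
Proof.
move=> w0; split=> [H | [aa ba] x]; last first.
  by rewrite /wedge aa ba mulr0 mul0r addr0 scale0r.
have wedgeC x : wedge al be w a x = wedge al be w x a.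
  by rewrite /wedge addrC.
split; apply/eqP.
  have /eqP := H v.
  by rewrite -wedgeC wedge_v scaler_eq0 (negPf w0) orbF.
have /eqP := H u.
by rewrite -wedgeC wedge_u scaler_eq0 (negPf w0) orbF.
Qed.

(** U is the kernel of x |-> (al(x), be(x)), a map onto F_2^2 because the dual
vectors are sent to the standard basis. *)
Lemma dim_codim2 (U : {vspace V n}) :
    (forall x, x \in U <-> ev al x = 0 /\ ev be x = 0) ->
  \dim U = (n - 2)%N.
Proof.
move=> UP.
pose f : 'Hom(V n, 'rV['F_2]_(1 + 1)) := linfun (mulmxr (row_mx al be)).
have fE x : f x = row_mx (ev al x)%:M (ev be x)%:M.
  by rewrite lfunE /= mul_mx_row /ev -!mx11_scalar.
have kerf : lker f = U.
  apply/vspaceP => x; rewrite memv_ker fE; apply/eqP/idP => [|/UP[-> ->]].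
    move=> e; apply/UP; split.
      have := congr1 (fun A => (lsubmx A) 0 0) e.
      by rewrite row_mxKl !mxE mulr1n.
    have := congr1 (fun A => (rsubmx A) 0 0) e.
    by rewrite row_mxKr !mxE mulr1n.
  by rewrite !raddf0 row_mx0.
have imf : limg f = fullv.
  apply/vspaceP => y; rewrite memvf; apply/memv_imgP.
  exists (y 0 0 *: u + y 0 1 *: v); first exact: memvf.
  case: uv => au bu av bv; rewrite fE !evD !evZ au bu av bv.
  rewrite !(mulr0, mulr1, addr0, add0r) -[LHS]hsubmxK.
  congr row_mx; apply/rowP => i; rewrite !mxE !ord1 mulr1n; congr (y 0 _);
  exact: val_inj.
have := limg_ker_dim f fullv; rewrite capfv kerf imf !dimVf.
by move=> dimE; rewrite -[X in (X - 2)%N]dimE addnK.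
Qed.

End Dual.

(** The functionals are the coordinates, in a basis of a complement of U, of
the projection along U. *)
Lemma codim2_functionals n (U : {vspace V n}) :
    (2 <= n)%N -> \dim U = (n - 2)%N ->
  exists al be u v, dual_to al be u v /\
    forall x, x \in U <-> ev al x = 0 /\ ev be x = 0.
Proof.
move=> n2 dimU; pose C := (U^C)%VS.
have [e eB] : exists e : 2.-tuple (V n), basis_of C e.
  have := vbasisP C; move: (vbasis C).
  have -> : \dim C = 2 by rewrite dimv_compl dimVf dimU subKn.
  by move=> e; exists e.
have CU0 : (C :&: U = 0)%VS by rewrite capvC capv_compl.
have CUf x : x \in (C + U)%VS by rewrite addvC addv_complf memvf.
pose p := daddv_pi C U.
have pU x : (x \in U) = (p x == 0).
  have xE := daddv_pi_add CU0 (CUf x).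
  apply/idP/eqP => [xU | px0].
    have : p x \in (C :&: U)%VS.
      rewrite memv_cap memv_pi /= -[p x](addrK (daddv_pi U C x)) xE.
      by rewrite memvB // memv_pi.
    by rewrite CU0 memv0 => /eqP.
  by rewrite -xE -/p px0 add0r memv_pi.
have freeE := basis_free eB.
have eC i : e`_i \in C.
  case: (ltnP i (size e)) => [lt_i | le_i]; last by rewrite nth_default ?mem0v.
  by rewrite (basis_mem eB) // mem_nth.
pose q i : {linear V n -> ('F_2)^o} := (coord e i \o p)%FUN.
have [al alE] := ev_of_linear (q 0); have [be beE] := ev_of_linear (q 1).
exists al, be, e`_0, e`_1; split.
  split; rewrite ?alE ?beE /= /p daddv_pi_id //.
  - by rewrite (coord_free 0 0 freeE).
  - by rewrite (coord_free 0 1 freeE).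
  - by rewrite (coord_free 1 0 freeE).
  - by rewrite (coord_free 1 1 freeE).
move=> x; rewrite pU alE beE /=; split=> [/eqP-> | [q0 q1]].
  by rewrite !linear0.
rewrite (coord_basis eB (memv_pi C U x)) !big_ord_recl big_ord0.
rewrite -/p (_ : lift _ _ = 1); last exact: val_inj.
by rewrite q0 q1 !scale0r !addr0.
Qed.

(** Modulo the annihilator, x is al(x) u + be(x) v, so that expanding both
factors leaves only multiples of m u v. This vector is nonzero, as otherwise
the whole of V would be the annihilator. *)
Lemma wedge_of_codim2 n (m : V n -> V n -> V n) (m_alg : alt_algebra m) :
    (2 <= n)%N -> \dim (W (circle_group m_alg)) = (n - 2)%N ->
  exists al be u v w, [/\ dual_to al be u v, w != 0, ev al w = 0, ev be w = 0
    & m =2 wedge al be w].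
Proof.
move=> n2 /(codim2_functionals n2)[al [be [u [v [uv WP]]]]].
have [mDl mxx mC mA] := m_alg.
have mZl c x y : m (c *: x) y = c *: m x y.
  by elim/F2_ind: c; rewrite ?scale0r ?scale1r ?(alt0l m_alg).
have [au bu av bv] := uv.
have red x y : m x y = ev al x *: m u y + ev be x *: m v y.
  rewrite -!mZl -mDl; set x' := _ + _.
  have : x + x' \in W (circle_group m_alg).
    apply/WP; rewrite !evD !evZ au bu av bv !(mulr0, mulr1, addr0, add0r).
    by split; [elim/F2_ind: (ev al x) | elim/F2_ind: (ev be x)]; apply: val_inj.
  move/W_circle/(_ y); rewrite mC mDl => /(congr1 (+%R (m x y))).
  by rewrite addKv addr0.
have mE : m =2 wedge al be (m u v).
  move=> x y; rewrite red (mC u) (mC v) !(red y) !mxx (mC v u) !scaler0.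
  by rewrite add0r addr0 !scalerA -scalerDl [ev be x * _]mulrC.
exists al, be, u, v, (m u v).
have [ ] : ev al (m u v) = 0 /\ ev be (m u v) = 0.
  apply/WP/W_circle => x; rewrite red -[m u _]mA mxx (alt0l m_alg).
  by rewrite [m v _]mC (alt_mulK m_alg) !scaler0 addr0.
split=> //; apply/eqP => w0.
have : u \in W (circle_group m_alg).
  by apply/W_circle => x; rewrite mE w0 /wedge scaler0.
by move/WP; rewrite au => -[].
Qed.

(** * Counting the parametrizations *)

Definition dpairs (T : finType) (A : {set T}) : {set T * T} :=
  [set p : T * T | [&& p.1 \in A, p.2 \in A & p.1 != p.2]].

Lemma card_dpairs (T : finType) (A : {set T}) :
  #|dpairs A| = (#|A| * #|A|.-1)%N.
Proof.
rewrite -sum1_card (eq_bigl (fun p => (p.1 \in A) && (p.2 \in A :\ p.1))).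
  rewrite -(pair_big_dep (fun x => x \in A) (fun x y => y \in A :\ x)
              (fun _ _ => 1%N)) /=.
  rewrite -sum_nat_const; apply: eq_bigr => x xA.
  by rewrite sum1_card (cardsD1 x A) xA.
by move=> [x y]; rewrite !inE /= [y == x]eq_sym [(_ != _) && _]andbC.
Qed.

Definition annihilator n (w : V n) : {set 'cV['F_2]_n} :=
  [set al : 'cV['F_2]_n | ev al w == 0].

(** Adding a functional d with d(w) = 1 exchanges the functionals that kill w
and those that do not, so that both kinds are equally numerous. *)
Lemma card_annihilator n (w : V n.+1) : w != 0 -> #|annihilator w| = (2 ^ n)%N.
Proof.
case/rV0Pn=> i /F2_neq0 wi; pose d : 'cV['F_2]_n.+1 := delta_mx i 0.
have dw : ev d w = 1 by rewrite /ev -colE mxE.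
have dC : ~: annihilator w = [set al + d | al in annihilator w].
  apply/setP => al; rewrite !inE; apply/idP/imsetP => [/F2_neq0 aw | [be]].
    exists (al - d); rewrite ?subrK // inE.
    have := evDl (al - d) d w; rewrite subrK aw dw.
    by elim/F2_ind: (ev (al - d) w).
  by rewrite inE => /eqP bw ->; rewrite evDl bw dw.
have := cardsC (annihilator w); rewrite dC card_imset; last exact: addIr.
rewrite card_mx card_Fp // muln1 addnn -mul2n expnS => /eqP.
by rewrite eqn_pmul2l // => /eqP.
Qed.

Definition triples n : {set V n * ('cV['F_2]_n * 'cV['F_2]_n)} :=
  [set t | (t.1 != 0) && (t.2 \in dpairs (annihilator t.1 :\ 0))].

Lemma card_triples n :
  #|triples n.+1| = ((2 ^ n.+1).-1 * ((2 ^ n).-1 * (2 ^ n).-2))%N.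
Proof.
pose D (w : V n.+1) := dpairs (annihilator w :\ 0).
rewrite -sum1_card (eq_bigl (fun t => (t.1 != 0) && (t.2 \in D t.1))).
  rewrite -(pair_big_dep (fun w : V n.+1 => w != 0) (fun w p => p \in D w)
              (fun _ _ => 1%N)) /=.
  transitivity (\sum_(w : V n.+1 | w != 0%R) ((2 ^ n).-1 * (2 ^ n).-2))%N.
    apply: eq_bigr => w w0; rewrite sum1_card card_dpairs.
    have := cardsD1 0 (annihilator w).
    by rewrite card_annihilator // inE ev0l eqxx => ->.
  rewrite sum_nat_const; congr (_ * _)%N.
  by rewrite -card_V -(cardC1 (0 : V n.+1)); apply: eq_card.
by move=> t; rewrite inE.
Qed.

(** The projective line through al and be: the nonzero vectors of the plane
that they span. *)
Definition line n (al be : 'cV['F_2]_n) : {set 'cV['F_2]_n} :=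
  [set al; be; al + be].

Lemma card_line n (al be : 'cV['F_2]_n) :
  al != 0 -> be != 0 -> al != be -> #|line al be| = 3.
Proof.
move=> al0 be0 neq; rewrite /line setUC cardsU1 cards2 !inE neq.
by rewrite negb_or -subr_eq0 addrC addKr be0 -subr_eq0 addrK al0.
Qed.

Lemma in_line n (al be ga : 'cV['F_2]_n) c d : ga != 0 ->
  (forall x, ev ga x = ev al x * c + d * ev be x) -> ga \in line al be.
Proof.
move=> ga0 gaE; have {gaE} gaE : ga = c *: al + d *: be.
  by apply: ev_inj => x; rewrite gaE evDl /ev -!scalemxAr !mxE [c * _]mulrC.
move: ga0; rewrite {}gaE !inE.
elim/F2_ind: c; elim/F2_ind: d;
  by rewrite ?scale0r ?scale1r ?(addr0, add0r) eqxx ?orbT.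
Qed.

(** A change of basis of the plane multiplies al /\ be by its determinant,
which is 1 over F_2. *)
Lemma wedge_line n (al be al' be' : 'cV_n) w :
  (al', be') \in dpairs (line al be) -> wedge al' be' w =2 wedge al be w.
Proof.
rewrite !inE /= => /and3P[/orP[/orP[]|] /eqP-> /orP[/orP[]|] /eqP->] //;
  rewrite ?eqxx // => _ x y; rewrite /wedge ?evDl; congr (_ *: _);
  elim/F2_ind: (ev al x); elim/F2_ind: (ev al y);
  elim/F2_ind: (ev be x); elim/F2_ind: (ev be y); exact: val_inj.
Qed.

(** Evaluating the form at vectors dual to al' and be' recovers these
functionals, as combinations of al and be. *)
Lemma wedge_injective n (al be al' be' : 'cV['F_2]_n) w w' :
    al' != 0 -> be' != 0 -> al' != be' -> w' != 0 ->
    wedge al' be' w' =2 wedge al be w ->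
  w' = w /\ (al', be') \in dpairs (line al be).
Proof.
move=> al0 be0 neq w0 eq_w.
have [u [v uv]] := dual_ex al0 be0 neq; have [au bu av bv] := uv.
have ew : w' = w.
  have := eq_w v u; rewrite (wedge_u uv) bv scale1r /wedge => w'E.
  move: w0; rewrite w'E scaler_eq0 negb_or => /andP[/F2_neq0-> _].
  by rewrite scale1r.
split=> //; subst w'; rewrite inE /= neq andbT.
have inj_w c d : c *: w = d *: w -> c = d.
  move/eqP; rewrite -subr_eq0 -scalerBl scaler_eq0 (negPf w0) orbF.
  by rewrite subr_eq0 => /eqP.
apply/andP; split.
  by apply: (in_line al0) => x; apply: inj_w; rewrite -(wedge_v uv) eq_w.
by apply: (in_line be0) => x; apply: inj_w; rewrite -(wedge_u uv) eq_w.
Qed.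

(** The generated group makes this a total function of the triple; on
[triples] it is the circle group itself, by [wedge_groupE]. *)
Definition wedge_group n (t : V n * ('cV['F_2]_n * 'cV['F_2]_n)) :
  {group {perm V n}} := <<circle (wedge t.2.1 t.2.2 t.1)>>%G.

Lemma triplesP n (w : V n) (al be : 'cV['F_2]_n) :
  reflect [/\ w != 0, [/\ al != 0, be != 0 & al != be]
             & ev al w = 0 /\ ev be w = 0]
          ((w, (al, be)) \in triples n).
Proof.
rewrite !inE /=; apply: (iffP and4P).
  by case=> w0 /andP[al0 /eqP aw] /andP[be0 /eqP bw] neq; split.
by case=> w0 [al0 be0 neq] [aw bw]; rewrite aw bw eqxx al0 be0; split.
Qed.

Lemma wedge_groupE n (w : V n) (al be : 'cV['F_2]_n)
    (m_alg : alt_algebra (wedge al be w)) :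
  wedge_group (w, (al, be)) = circle_group m_alg.
Proof.
by apply: val_inj; rewrite /= gen_set_id //; apply: circle_group_set.
Qed.

Lemma wedge_group_fibre n t : t \in triples n ->
  [set t' in triples n | wedge_group t' == wedge_group t]
  = setX [set t.1] (dpairs (line t.2.1 t.2.2)).
Proof.
case: t => w [al be] /triplesP[w0 [al0 be0 neq] [aw bw]].
have m_alg := wedge_alg aw bw.
apply/setP => -[w' [al' be']]; rewrite in_setX inE in_set1 /=.
apply/andP/andP =>
  [[/triplesP[w0' [al0' be0' neq'] [aw' bw']]] | [/eqP-> line']].
  have m_alg' := wedge_alg aw' bw'.
  rewrite (wedge_groupE m_alg) (wedge_groupE m_alg') => /eqP/(congr1 val)/=.
  move/(circle_injective m_alg').
  by case/(wedge_injective al0' be0' neq' w0') => ->.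
have eq_m := wedge_line w line'.
have span ga : ga \in line al be -> ga != 0 /\ ev ga w = 0.
  rewrite !inE => /orP[/orP[]|] /eqP->; split=> //.
    apply: contra neq => /eqP e; apply/eqP/ev_inj => x.
    have := ev0l x; rewrite -e evDl.
    by elim/F2_ind: (ev al x); elim/F2_ind: (ev be x).
  by rewrite evDl aw bw addr0.
move: (line'); rewrite inE /= => /and3P[/span[al0' aw'] /span[be0' bw'] neq'].
split; first by apply/triplesP.
rewrite /wedge_group /=; apply/eqP/val_inj; rewrite /=; congr <<_>>.
by apply/setP => g; apply/circleP/circleP => gE x; rewrite gE /= eq_m.
Qed.

Lemma card_wedge_groups n :
  (#|[set wedge_group t | t in triples n]| * 6 = #|triples n|)%N.
Proof.
rewrite -sum_nat_const -[RHS]sum1_card (partition_big_imset (@wedge_group n)).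
apply: eq_bigr => _ /imsetP[t tT ->].
case: t tT => w [al be] tT.
have [_ [al0 be0 neq] _] := triplesP _ _ _ tT.
rewrite sum1dep_card (wedge_group_fibre tT) cardsX cards1 card_dpairs /=.
by rewrite card_line.
Qed.

Lemma wedge_groups n : (2 <= n)%N ->
  [set wedge_group t | t in triples n] =
  [set G : {group {perm V n}} |
     [&& G \subset AGL n, is_abelem G, regular G & \dim (W G) == (n - 2)%N]].
Proof.
move=> n2; apply/setP => G; rewrite inE; apply/imsetP/and4P.
  case=> -[w [al be]] /triplesP[w0 [al0 be0 neq] [aw bw]] ->.
  have m_alg := wedge_alg aw bw; rewrite (wedge_groupE m_alg).
  split; first exact: circle_AGL.
  - exact: circle_abelem.
  - exact: circle_regular.
  have [u [v uv]] := dual_ex al0 be0 neq.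
  apply/eqP/(dim_codim2 uv) => x; rewrite -(wedge_ann uv x w0).
  by split=> [/W_circle | ?]; last apply/W_circle.
case=> sGA abG regG /eqP dimG.
have [m m_alg defG] := circle_of_regular sGA abG regG.
have {}defG : G = circle_group m_alg by apply: val_inj.
rewrite defG in dimG *.
have [al [be [u [v [w [uv w0 aw bw mE]]]]]] := wedge_of_codim2 n2 dimG.
exists (w, (al, be)); first by apply/triplesP; split=> //; apply: dual_neq uv.
rewrite (wedge_groupE (wedge_alg aw bw)); apply: val_inj.
by apply/setP => g; apply/circleP/circleP => gE x; rewrite gE mE.
Qed.

(** Passing from m to m + 1 adds one factor to the product, (2^(m+3) - 1) over
(2^(m+1) - 1), and the quotients telescope. *)
Lemma gauss_binom_codim2 m :
  gauss_binom 2 m.+2 m * 3%:R = (2%:R ^+ m.+2 - 1) * (2%:R ^+ m.+1 - 1).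
Proof.
have nz k : 2%:R ^+ k.+1 - 1 != 0 :> rat.
  rewrite subr_eq0 -natrX -[1]/(1%:R) (Num.Theory.eqr_nat rat) gtn_eqF //.
  by rewrite -{1}(expn0 2) ltn_exp2l.
elim: m => [|m IHm]; first by rewrite /gauss_binom big_ord0.
have -> : gauss_binom 2 m.+3 m.+1
  = (2%:R ^+ m.+3 - 1) / (2%:R ^+ m.+1 - 1) * gauss_binom 2 m.+2 m.
  by rewrite /gauss_binom big_ord_recl.
rewrite -[_ * 3%:R]mulrA IHm; field; exact: nz.
Qed.

Theorem corollary4p9 (n : nat) (hn : (2 <= n)%N) :
  (#|[set G : {group {perm V n}} |
        [&& G \subset AGL n, is_abelem G, regular G
          & \dim (W G) == (n - 2)%N]]|%:R
   = gauss_binom 2 n (n - 2) * (2%:R ^+ (n - 2) - 1) :> rat)%R.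
Proof.
rewrite -wedge_groups //.
case: n hn => [|[|m]] // _; rewrite subSS subSS subn0.
have := congr1 (fun k => k%:R : rat) (card_wedge_groups m.+2).
set N := #|_|; rewrite card_triples !natrM.
have predE k : (2 ^ k).-1%:R = 2%:R ^+ k - 1 :> rat.
  by rewrite -subn1 natrB ?expn_gt0 // natrX.
have -> : ((2 ^ m.+1).-2 = 2 * (2 ^ m).-1)%N.
  by rewrite expnS -{1}(prednK (expn_gt0 2 m)) mulnS.
rewrite natrM !predE => NE.
have six : 6%:R != 0 :> rat by [].
apply: (mulIf six); rewrite NE.
have -> : 6%:R = 3%:R * 2%:R :> rat by [].
rewrite mulrAC [_ * (3%:R * _)]mulrA gauss_binom_codim2; ring.
Qed.
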